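(* Let $\nu>-1$ and let $j_{\nu,1}$ be the first positive zero of the Bessel function of the first kind $J_\nu$. Put $\gamma_\nu=\frac{j_{\nu,1}^2}{4(\nu+2)}$ and $\delta_\nu=0$. Then for all real $x$ with $|x|<j_{\nu,1}$, $$\left(\frac{j_{\nu,1}^2-x^2}{j_{\nu,1}^2}\right)^{\gamma_\nu}\leq\mathcal{J}_{\nu+1}(x)\leq\left(\frac{j_{\nu,1}^2-x^2}{j_{\nu,1}^2}\right)^{\delta_\nu}.$$ Moreover the constants $\gamma_\nu$ and $\delta_\nu$ are best possible: $\gamma_\nu$ is the smallest real number $\gamma$ such that $\left(\frac{j_{\nu,1}^2-x^2}{j_{\nu,1}^2}\right)^{\gamma}\le\mathcal{J}_{\nu+1}(x)$ for all $|x|<j_{\nu,1}$, and $\delta_\nu$ is the largest real number $\delta$ such that $\mathcal{J}_{\nu+1}(x)\le\left(\frac{j_{\nu,1}^2-x^2}{j_{\nu,1}^2}\right)^{\delta}$ for all $|x|<j_{\nu,1}$.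
   Context: For $\nu>-1$, $J_\nu$ is the Bessel function of the first kind, $J_\nu(x)=\sum_{n\ge0}\frac{(-1)^n}{n!\,\Gamma(\nu+n+1)}\left(\frac{x}{2}\right)^{2n+\nu}$ for $x>0$, and $j_{\nu,1}$ is its smallest positive zero. The normalized Bessel function is $\mathcal{J}_\nu(x)=\sum_{n\ge0}\frac{(-1)^n\,\Gamma(\nu+1)}{n!\,\Gamma(\nu+n+1)}\left(\frac{x}{2}\right)^{2n}$ for $x\in\mathbb{R}$; thus $\mathcal{J}_\nu(x)=2^\nu\Gamma(\nu+1)x^{-\nu}J_\nu(x)$ for $x>0$ and $\mathcal{J}_\nu(0)=1$. *)

(* Defs.v *)
(* Stdlib real numbers, with Coquelicot for series and improper integrals. *)
From Stdlib Require Import Reals Factorial.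
From Coquelicot Require Import Coquelicot.
Local Open Scope R_scope.

(* Euler's integral, convergent for s > 0; the definitions below use it only
   at such arguments when -1 < nu. *)
Definition Gamma (s : R) : R :=
  RInt_gen (fun t : R => Rpower t (s - 1) * exp (- t))
    (at_right 0) (Rbar_locally p_infty).

(* Meaningful for x > 0 only, because of the real power (x/2)^(2n+nu). *)
Definition BesselJ (nu x : R) : R :=
  Series (fun n : nat =>
    (-1) ^ n / (INR (fact n) * Gamma (nu + INR n + 1))
    * Rpower (x / 2) (2 * INR n + nu)).

Definition NormBesselJ (nu x : R) : R :=
  Series (fun n : nat =>
    (-1) ^ n * Gamma (nu + 1) / (INR (fact n) * Gamma (nu + INR n + 1))
    * (x / 2) ^ (2 * n)).

Definition is_smallest (P : R -> Prop) (m : R) : Prop :=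
  P m /\ forall y : R, P y -> m <= y.

Definition is_largest (P : R -> Prop) (m : R) : Prop :=
  P m /\ forall y : R, P y -> y <= m.

Definition is_first_positive_zero (f : R -> R) (j : R) : Prop :=
  is_smallest (fun x : R => 0 < x /\ f x = 0) j.

(* Main.v *)
(* Write [t = x^2], [T = j^2], [a = nu + 1], and let [A], [B] be the normalized
   Bessel functions of orders [a], [a + 1] as functions of [t]; then
   [A' = - B / (4 (a + 1))].  Since [(t^a A)' = a t^(a-1) J] with [J] the function
   of order [nu], positivity on [[0, T]] passes from [J] to [A], and likewise to [B].
   The lower bound says that [ln A - gamma ln (1 - t / T)] is nonnegative;
   differentiating, it suffices that [A / B >= 1 - t / T].  This holds because
   [v = 4 (a + 1) A / B], the solution of the Riccati equation
   [t v' = - t + (a + 1) v - v^2 / 4] regular at [0], is concave: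
   [t^(a+3) B^2 v''] has derivative [- t^(a+2) B^2 v'^2 / 2] and limit [0] at [0].
   Expanding at [x = 0] shows that [gamma] is optimal, and [A T > 0] that
   [delta] is. *)
Require Import Defs.
From Stdlib Require Import Reals Lra Factorial Classical.
From Coquelicot Require Import Coquelicot.
Local Open Scope R_scope.

(** * Real powers near [0] and against the exponential *)

Lemma is_derive_Rpower (e x : R) :
  0 < x -> is_derive (fun y => Rpower y e) x (e * Rpower x (e - 1)).
Proof. now intros Hx; apply is_derive_Reals, derivable_pt_lim_power. Qed.

Lemma filterlim_Rpower_at_right_0 (e : R) :
  0 < e -> filterlim (fun t => Rpower t e) (at_right 0) (locally 0).
Proof.
  intros He. apply filterlim_locally. intros eps.
  assert (Hd : 0 < Rpower eps (/ e)) by apply exp_pos.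
  exists (mkposreal _ Hd). intros t Ht Ht0.
  change (Rabs (t - 0) < Rpower eps (/ e)) in Ht.
  change (Rabs (Rpower t e - 0) < eps).
  rewrite Rminus_0_r, Rabs_pos_eq in * by (try apply Rlt_le, exp_pos; lra).
  replace (pos eps) with (Rpower (Rpower eps (/ e)) e).
  - apply Rlt_Rpower_l; lra.
  - rewrite Rpower_mult, Rinv_l, Rpower_1; [reflexivity | apply eps | lra].
Qed.

Lemma filterlim_Rpower_mult_at_right_0 (e : R) (g : R -> R) :
  0 < e -> continuous g 0 ->
  filterlim (fun t => Rpower t e * g t) (at_right 0) (locally 0).
Proof.
  intros He Hg. replace (locally 0) with (locally (mult 0 (g 0)))
    by (f_equal; apply Rmult_0_l).
  apply (@filterlim_comp_2 R R R R _ (locally 0) (locally (g 0)) _ _ (fun t => Rpower t e) g mult).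
  - now apply filterlim_Rpower_at_right_0.
  - apply filterlim_filter_le_1 with (2 := Hg). apply filter_le_within.
  - apply @filterlim_mult.
Qed.

(** This is [1 + ln u <= u] at [u = t / (2 * s)], multiplied by [s]. The rate [1 / 2] makes the
    square of the bound grow only like [exp t]. *)
Lemma Rpower_le_exp_half (s t : R) :
  0 < s -> 0 < t -> Rpower t s <= Rpower (2 * s) s * exp (t / 2).
Proof.
  intros Hs Ht. unfold Rpower. rewrite <- exp_plus.
  assert (H := exp_ineq1_le (ln (t / (2 * s)))).
  rewrite exp_ln in H by (apply Rdiv_lt_0_compat; lra).
  rewrite ln_div in H by lra.
  assert (E : t / 2 = s * (t / (2 * s))) by (field; lra).
  apply Rnot_lt_le. intros C. apply exp_lt_inv in C. rewrite E in C.
  nra.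
Qed.

(** * Euler's integral: convergence, positivity, functional equation *)

Definition gamma_integrand (s t : R) : R := Rpower t (s - 1) * exp (- t).

Lemma gamma_integrand_pos (s t : R) : 0 < gamma_integrand s t.
Proof. apply Rmult_lt_0_compat; apply exp_pos. Qed.

Lemma continuous_gamma_integrand (s t : R) :
  0 < t -> continuous (gamma_integrand s) t.
Proof.
  intros Ht. apply @ex_derive_continuous.
  unfold gamma_integrand, Rpower. auto_derive. exact Ht.
Qed.

Lemma ex_RInt_gamma_integrand (s a b : R) :
  0 < a -> a <= b -> ex_RInt (gamma_integrand s) a b.
Proof.
  intros Ha Hab. apply @ex_RInt_continuous. intros z Hz.
  rewrite Rmin_left in Hz by lra. apply continuous_gamma_integrand. lra.
Qed.

(* The integrand is dominated by a multiple of the derivative of the bounded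
   function [- 1 / (1 + t^s)], uniformly on the whole half line. *)
Lemma RInt_gamma_integrand_bounded (s : R) :
  0 < s -> exists M, forall a b, 0 < a -> a <= b ->
    RInt (gamma_integrand s) a b <= M.
Proof.
  intros Hs.
  (* With this [C], [1 + t^s <= C exp (t / 2)], so [exp (- t) <= C^2 / (1 + t^s)^2]. Hence the
     integrand is at most [h = H'], and [H] stays between [- C^2 / s] and [0]. *)
  set (C := 1 + Rpower (2 * s) s).
  set (H := fun t => - (C ^ 2 / s) * / (1 + Rpower t s)).
  set (h := fun t => C ^ 2 * Rpower t (s - 1) / (1 + Rpower t s) ^ 2).
  assert (P : forall t, 0 < Rpower t s) by (intros; apply exp_pos).
  exists (C ^ 2 / s). intros a b Ha Hab.
  assert (I : is_RInt h a b (minus (H b) (H a))).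
  { apply (is_RInt_derive H h); intros t;
      rewrite Rmin_left, Rmax_right by lra; intros Ht; specialize (P t).
    - unfold H, h. evar_last.
      + apply is_derive_scal, is_derive_inv; [ | lra].
        apply @is_derive_plus; [apply @is_derive_const | apply is_derive_Rpower; lra].
      + unfold plus, zero; simpl. field. lra.
    - apply @ex_derive_continuous. unfold h, Rpower. auto_derive.
      repeat split; try lra. fold (Rpower t s).
      rewrite Rmult_1_r. nra. }
  apply Rle_trans with (RInt h a b).
  - apply RInt_le; [lra | now apply ex_RInt_gamma_integrand | now exists (minus (H b) (H a)) | ].
    intros t Ht. unfold h, gamma_integrand. specialize (P t).
    assert (E1 : 1 < exp (t / 2)) by (rewrite <- exp_0; apply exp_increasing; lra).
    assert (E2 := Rpower_le_exp_half s t Hs ltac:(lra)).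
    assert (E3 : 1 + Rpower t s <= C * exp (t / 2)) by (unfold C; nra).
    assert (E4 : exp (- t) * exp (t / 2) ^ 2 = 1).
    { simpl. rewrite Rmult_1_r, <- !exp_plus, <- exp_0. f_equal. field. }
    assert (E5 : (1 + Rpower t s) ^ 2 <= (C * exp (t / 2)) ^ 2) by (apply pow_incr; lra).
    apply Rmult_le_reg_r with ((1 + Rpower t s) ^ 2); [apply pow_lt; lra | ].
    replace (C ^ 2 * Rpower t (s - 1) / (1 + Rpower t s) ^ 2 * (1 + Rpower t s) ^ 2)
      with (Rpower t (s - 1) * C ^ 2) by (field; lra).
    rewrite Rmult_assoc. apply Rmult_le_compat_l; [apply Rlt_le, exp_pos | ].
    replace (C ^ 2) with (exp (- t) * (C * exp (t / 2)) ^ 2).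
    + apply Rmult_le_compat_l; [apply Rlt_le, exp_pos | assumption].
    + rewrite Rpow_mult_distr. rewrite <- (Rmult_1_r (C ^ 2)) at 2. rewrite <- E4. ring.
  - rewrite (is_RInt_unique _ _ _ _ I). unfold H, minus, plus, opp; simpl.
    assert (K : 0 < C ^ 2 / s).
    { assert (Q : 0 < Rpower (2 * s) s) by apply exp_pos.
      apply Rdiv_lt_0_compat; [apply pow_lt; unfold C; lra | lra]. }
    simpl in K.
    assert (U : 0 < / (1 + Rpower b s)) by (apply Rinv_0_lt_compat; specialize (P b); lra).
    assert (V : / (1 + Rpower a s) <= 1).
    { rewrite <- Rinv_1. apply Rinv_le_contravar; specialize (P a); lra. }
    nra.
Qed.

(** The integrand is positive, so its integrals grow with the interval; being bounded, they converge
    to their supremum, which is [Gamma s] by uniqueness of the limit. *)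
Lemma is_RInt_gen_Gamma (s : R) : 0 < s ->
  is_RInt_gen (gamma_integrand s) (at_right 0) (Rbar_locally p_infty) (Gamma s)
  /\ 0 < Gamma s.
Proof.
  intros Hs.
  set (E := fun y => exists a b, 0 < a <= 1 /\ 2 <= b /\ y = RInt (gamma_integrand s) a b).
  assert (Hb : bound E).
  { destruct (RInt_gamma_integrand_bounded s Hs) as [M HM]. exists M.
    intros y (a & b & Ha & Hb & ->). apply HM; lra. }
  assert (H12 : E (RInt (gamma_integrand s) 1 2)).
  { exists 1, 2. repeat split; lra. }
  destruct (completeness E Hb (ex_intro _ _ H12)) as [l [Hu Hl]].
  assert (L : is_RInt_gen (gamma_integrand s) (at_right 0) (Rbar_locally p_infty) l).
  { intros P [eps HP].
    assert (X : exists a b, 0 < a <= 1 /\ 2 <= b /\ l - eps < RInt (gamma_integrand s) a b).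
    { apply NNPP. intros N. apply (Rlt_irrefl l), Rle_lt_trans with (l - eps).
      - apply Hl. intros y (a & b & Ha & Hab & ->). apply Rnot_lt_le.
        intros C. apply N. now exists a, b.
      - generalize (cond_pos eps). lra. }
    destruct X as (a0 & b0 & Ha0 & Hb0 & X).
    apply Filter_prod with (fun a => 0 < a < a0) (fun b => b0 < b).
    - exists (mkposreal a0 (proj1 Ha0)). intros a Ha Hpos.
      apply Rabs_lt_between' in Ha. simpl in Ha. lra.
    - now exists b0.
    - intros a b Ha Hab. exists (RInt (gamma_integrand s) a b). split.
      + apply @RInt_correct, ex_RInt_gamma_integrand; simpl; lra.
      + apply HP. apply Rabs_lt_between'.
        assert (RInt (gamma_integrand s) a b <= l) by (apply Hu; exists a, b; repeat split; lra).
        enough (RInt (gamma_integrand s) a0 b0 <= RInt (gamma_integrand s) a b)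
          by (generalize (cond_pos eps); lra).
        assert (Q : forall u v, 0 < u -> u <= v -> 0 <= RInt (gamma_integrand s) u v).
        { intros u v Hu0 Huv. apply RInt_ge_0; [lra | now apply ex_RInt_gamma_integrand | ].
          intros; apply Rlt_le, gamma_integrand_pos. }
        rewrite <- (RInt_Chasles (gamma_integrand s) a a0 b)
          by (apply ex_RInt_gamma_integrand; lra).
        rewrite <- (RInt_Chasles (gamma_integrand s) a0 b0 b)
          by (apply ex_RInt_gamma_integrand; lra).
        assert (Q1 := Q a a0 ltac:(lra) ltac:(lra)).
        assert (Q2 := Q b0 b ltac:(lra) ltac:(lra)).
        unfold plus; simpl. lra. }
  assert (G : Gamma s = l).
  { unfold Gamma. now apply is_RInt_gen_unique. }
  rewrite G. split; [exact L | ].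
  apply Rlt_le_trans with (2 := Hu _ H12).
  apply RInt_gt_0; [lra | intros; apply gamma_integrand_pos | ].
  intros; apply continuous_gamma_integrand; lra.
Qed.

Lemma filterlim_Rpower_exp_opp (s : R) : 0 < s ->
  filterlim (fun t => Rpower t s * exp (- t)) (Rbar_locally p_infty) (locally 0).
Proof.
  (* The exponent [s + 1] gives [t * t^s * exp (- t) <= C], so the function is at most [C / t],
     below [eps] once [t > C / eps]. *)
  intros Hs. set (C := Rpower (2 * (s + 1)) (s + 1)).
  assert (HC : 0 < C) by apply exp_pos.
  apply filterlim_locally. intros eps. assert (He := cond_pos eps).
  exists (C / eps). intros t Ht.
  assert (Ht0 : 0 < t) by (apply Rlt_trans with (2 := Ht), Rdiv_lt_0_compat; lra).
  assert (P : 0 < Rpower t s * exp (- t)) by (apply Rmult_lt_0_compat; apply exp_pos).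
  change (Rabs (Rpower t s * exp (- t) - 0) < eps).
  rewrite Rminus_0_r, Rabs_pos_eq by lra.
  assert (B := Rpower_le_exp_half (s + 1) t ltac:(lra) Ht0). fold C in B.
  rewrite Rpower_plus, Rpower_1 in B by lra.
  assert (E : exp (t / 2) * exp (- t) <= 1).
  { rewrite <- exp_plus, <- exp_0. apply Rlt_le, exp_increasing. lra. }
  assert (F := exp_pos (- t)).
  assert (Ht' : C < t * eps).
  { apply Rmult_lt_compat_r with (r := eps) in Ht; [ | lra].
    replace (C / eps * eps) with C in Ht by (field; lra). lra. }
  apply Rmult_lt_reg_r with t; [lra | ].
  apply Rle_lt_trans with C; [ | lra].
  apply Rle_trans with (C * exp (t / 2) * exp (- t)); nra.
Qed.

(** Integration by parts: [g = - t^s exp (- t)] tends to [0] at both ends, and [g'] is the integrand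
    at [s + 1] minus [s] times the one at [s]. *)
Lemma Gamma_succ (s : R) : 0 < s -> Gamma (s + 1) = s * Gamma s.
Proof.
  intros Hs.
  set (g := fun t => - (Rpower t s * exp (- t))).
  set (dg := fun t => gamma_integrand (s + 1) t - s * gamma_integrand s t).
  assert (D : forall t, 0 < t -> is_derive g t (dg t)).
  { intros t Ht. unfold g, dg, gamma_integrand.
    evar_last.
    - apply (is_derive_opp (fun t => Rpower t s * exp (- t)) t).
      apply (Derive.is_derive_mult (fun t => Rpower t s) (fun t => exp (- t)));
        [now apply is_derive_Rpower | ].
      auto_derive; [exact I | reflexivity].
    - unfold opp, plus, mult; simpl. replace (s + 1 - 1) with s by ring. ring. }
  (* Both ends of the interval are eventually positive, so the formula for [g'], established for
     [t > 0], applies throughout. *)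
  assert (Near : filter_prod (at_right 0) (Rbar_locally p_infty)
     (fun ab : R * R => 0 < fst ab /\ 0 < snd ab)).
  { apply Filter_prod with (fun a => 0 < a) (fun b => 0 < b).
    - exists (mkposreal 1 Rlt_0_1). intros a _ Ha. exact Ha.
    - exists 0. auto.
    - simpl; auto. }
  assert (Pos : forall ab : R * R, 0 < fst ab /\ 0 < snd ab ->
     forall x, Rmin (fst ab) (snd ab) <= x -> 0 < x).
  { intros ab H x Hx. apply Rlt_le_trans with (2 := Hx). now apply Rmin_glb_lt. }
  assert (I0 : is_RInt_gen (Derive g) (at_right 0) (Rbar_locally p_infty) (0 - 0)).
  { apply is_RInt_gen_Derive.
    - apply filter_imp with (2 := Near). intros ab H x Hx. eexists.
      apply D, (Pos ab H x), Hx.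
    - apply filter_imp with (2 := Near). intros ab H x Hx.
      assert (Hx0 := Pos ab H x (proj1 Hx)).
      apply continuous_ext_loc with dg.
      + exists (mkposreal x Hx0). intros y Hy. apply Rabs_lt_between' in Hy. simpl in Hy.
        symmetry. apply is_derive_unique, D. lra.
      + apply @continuous_minus; [now apply continuous_gamma_integrand | ].
        apply @continuous_scal_r. now apply continuous_gamma_integrand.
    - replace (locally 0) with (locally (opp 0)) by (f_equal; apply Ropp_0).
      apply filterlim_comp with (2 := filterlim_opp 0).
      apply filterlim_Rpower_mult_at_right_0; [exact Hs | ].
      apply @ex_derive_continuous. auto_derive. exact I.
    - replace (locally 0) with (locally (opp 0)) by (f_equal; apply Ropp_0).
      apply filterlim_comp with (2 := filterlim_opp 0).
      now apply filterlim_Rpower_exp_opp. }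
  destruct (is_RInt_gen_Gamma s Hs) as [I1 _].
  unfold Gamma at 1. apply is_RInt_gen_unique.
  replace (s * Gamma s) with (plus (0 - 0) (scal s (Gamma s)))
    by (unfold plus, scal; simpl; unfold mult; simpl; ring).
  apply is_RInt_gen_ext with (fun t => plus (Derive g t) (scal s (gamma_integrand s t))).
  - apply filter_imp with (2 := Near). intros ab H x Hx.
    rewrite (is_derive_unique _ _ _ (D x (Pos ab H x (Rlt_le _ _ (proj1 Hx))))).
    unfold dg, plus, scal; simpl; unfold mult; simpl.
    unfold gamma_integrand. ring.
  - apply (is_RInt_gen_plus (Derive g)); [exact I0 | ].
    now apply (is_RInt_gen_scal (gamma_integrand s)).
Qed.

(** * The power series of the normalized Bessel function in [t = x^2] *)

Fixpoint pochhammer (x : R) (n : nat) : R :=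
  match n with
  | O => 1
  | S m => pochhammer x m * (x + INR m)
  end.

Lemma pochhammer_pos (x : R) (n : nat) : 0 < x -> 0 < pochhammer x n.
Proof.
  intros Hx. induction n as [ | n IH]; [simpl; lra | ].
  apply Rmult_lt_0_compat; [exact IH | generalize (pos_INR n); lra].
Qed.

Lemma pochhammer_shift (x : R) (n : nat) :
  pochhammer x n * (x + INR n) = x * pochhammer (x + 1) n.
Proof.
  induction n as [ | n IH]; [simpl; ring | ].
  change (pochhammer x (S n)) with (pochhammer x n * (x + INR n)).
  rewrite IH, S_INR. simpl. ring.
Qed.

Lemma Gamma_pochhammer (s : R) (n : nat) :
  0 < s -> Gamma (s + INR n) = Gamma s * pochhammer s n.
Proof.
  intros Hs. induction n as [ | n IH]; [simpl; rewrite Rplus_0_r; ring | ].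
  rewrite S_INR, <- Rplus_assoc, Gamma_succ by (generalize (pos_INR n); lra).
  rewrite IH. simpl. ring.
Qed.

(** The Gamma quotient is written as a rising factorial, so that neighbouring orders compare by
    rational factors. *)
Definition bessel_coeff (a : R) (n : nat) : R :=
  (- / 4) ^ n / (INR (fact n) * pochhammer (a + 1) n).

(* The normalized Bessel function as an entire function of [t = x^2]. *)
Definition bessel_entire (a : R) : R -> R := PSeries (bessel_coeff a).

Lemma NormBesselJ_entire (a x : R) :
  -1 < a -> NormBesselJ a x = bessel_entire a (x ^ 2).
Proof.
  intros Ha. unfold NormBesselJ, bessel_entire, PSeries.
  apply Series_ext. intros n.
  replace (a + INR n + 1) with (a + 1 + INR n) by ring.
  rewrite Gamma_pochhammer by lra.
  assert (P := pochhammer_pos (a + 1) n ltac:(lra)).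
  assert (F := INR_fact_lt_0 n).
  destruct (is_RInt_gen_Gamma (a + 1) ltac:(lra)) as [_ G].
  unfold bessel_coeff. rewrite pow_mult.
  replace ((x / 2) ^ 2) with (/ 4 * x ^ 2) by field.
  replace (- / 4) with (-1 * / 4) by ring.
  rewrite !Rpow_mult_distr. field. lra.
Qed.

Lemma BesselJ_entire (a x : R) : -1 < a -> 0 < x ->
  BesselJ a x = Rpower (x / 2) a / Gamma (a + 1) * bessel_entire a (x ^ 2).
Proof.
  intros Ha Hx. unfold BesselJ, bessel_entire, PSeries.
  rewrite <- Series_scal_l. apply Series_ext. intros n.
  replace (a + INR n + 1) with (a + 1 + INR n) by ring.
  rewrite Gamma_pochhammer by lra.
  assert (P := pochhammer_pos (a + 1) n ltac:(lra)).
  assert (F := INR_fact_lt_0 n).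
  destruct (is_RInt_gen_Gamma (a + 1) ltac:(lra)) as [_ G].
  rewrite Rpower_plus.
  replace (2 * INR n) with (INR (2 * n)) by (rewrite mult_INR; reflexivity).
  rewrite Rpower_pow by lra.
  unfold bessel_coeff. rewrite pow_mult.
  replace ((x / 2) ^ 2) with (/ 4 * x ^ 2) by field.
  replace (- / 4) with (-1 * / 4) by ring.
  rewrite !Rpow_mult_distr. field. lra.
Qed.

Lemma bessel_entire_0 (a : R) : bessel_entire a 0 = 1.
Proof.
  unfold bessel_entire. rewrite PSeries_0. unfold bessel_coeff. simpl. field.
Qed.

Lemma CV_radius_bessel (a : R) : -1 < a -> CV_radius (bessel_coeff a) = p_infty.
Proof.
  intros Ha.
  assert (Hnz : forall n, bessel_coeff a n <> 0).
  { intros n. unfold bessel_coeff. apply Rmult_integral_contrapositive_currified.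
    - apply pow_nonzero. lra.
    - apply Rinv_neq_0_compat, Rmult_integral_contrapositive_currified.
      + apply INR_fact_neq_0.
      + apply Rgt_not_eq, pochhammer_pos. lra. }
  apply CV_radius_infinite_DAlembert; [exact Hnz | ].
  (* The ratio of successive coefficients is [- 1 / (4 (n + 1) (a + 1 + n))]; replacing [a + 1 + n]
     by [a + 1] leaves a multiple of [1 / (n + 1)]. *)
  apply is_lim_seq_le_le with (fun _ => 0) (fun n => / (4 * (a + 1)) * / (INR n + 1)).
  - intros n. split; [apply Rabs_pos | ].
    assert (N := pos_INR n).
    assert (E : bessel_coeff a (S n) / bessel_coeff a n
                = - (/ 4 * / (INR n + 1) * / (a + 1 + INR n))).
    { unfold bessel_coeff. rewrite fact_simpl, mult_INR, S_INR.
      assert (P := pochhammer_pos (a + 1) n ltac:(lra)).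
      assert (F := INR_fact_lt_0 n).
      assert (Q : (- / 4) ^ n <> 0) by (apply pow_nonzero; lra).
      simpl. field. repeat split; lra. }
    rewrite E, Rabs_Ropp, Rabs_pos_eq.
    + rewrite Rinv_mult, (Rmult_assoc (/ 4)), (Rmult_comm (/ (INR n + 1))), <- Rmult_assoc.
      apply Rmult_le_compat_r; [apply Rlt_le, Rinv_0_lt_compat; lra | ].
      apply Rmult_le_compat_l; [lra | ]. apply Rinv_le_contravar; lra.
    + repeat apply Rmult_le_pos; try lra; apply Rlt_le, Rinv_0_lt_compat; lra.
  - apply is_lim_seq_const.
  - replace (Finite 0) with (Rbar_mult (/ (4 * (a + 1))) 0)
      by (simpl; f_equal; ring).
    apply is_lim_seq_scal_l.
    replace (Finite 0) with (Rbar_inv p_infty) by reflexivity.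
    apply is_lim_seq_inv; [ | discriminate].
    apply is_lim_seq_ext with (fun n => INR (S n)); [intros; apply S_INR | ].
    apply (is_lim_seq_incr_1 INR), is_lim_seq_INR.
Qed.

Lemma ex_pseries_bessel (a t : R) : -1 < a -> ex_pseries (bessel_coeff a) t.
Proof.
  intros Ha. apply CV_radius_inside. now rewrite CV_radius_bessel.
Qed.

(** * Relations between neighbouring orders *)

(** Coefficient form of [A' = - B / (4 (a + 1))]. *)
Lemma bessel_coeff_succ (a : R) (n : nat) : -1 < a ->
  INR (S n) * bessel_coeff a (S n) = - / (4 * (a + 1)) * bessel_coeff (a + 1) n.
Proof.
  intros Ha. unfold bessel_coeff.
  assert (E := pochhammer_shift (a + 1) n).
  assert (P' := pochhammer_pos (a + 1 + 1) n ltac:(lra)).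
  assert (F := INR_fact_lt_0 n). assert (N := pos_INR n).
  change (pochhammer (a + 1) (S n)) with (pochhammer (a + 1) n * (a + 1 + INR n)).
  rewrite E, fact_simpl, mult_INR, S_INR, <- tech_pow_Rmult.
  field. lra.
Qed.

(** Coefficient form of [t A' = a (J - A)], with [J] of order [a - 1]: this is the formula for
    [(t^a A)'] cleared of powers of [t]. *)
Lemma bessel_coeff_lower (a : R) (n : nat) : 0 < a ->
  INR n * bessel_coeff a n = a * (bessel_coeff (a - 1) n - bessel_coeff a n).
Proof.
  intros Ha. unfold bessel_coeff. replace (a - 1 + 1) with a by ring.
  assert (E := pochhammer_shift a n).
  assert (P := pochhammer_pos a n Ha).
  assert (F := INR_fact_lt_0 n). assert (N := pos_INR n).
  replace (pochhammer (a + 1) n) with (pochhammer a n * (a + INR n) / a)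
    by (rewrite E; field; lra).
  field. lra.
Qed.

Lemma is_derive_bessel_entire (a t : R) : -1 < a ->
  is_derive (bessel_entire a) t (- bessel_entire (a + 1) t / (4 * (a + 1))).
Proof.
  intros Ha. evar_last.
  - apply is_derive_PSeries. now rewrite CV_radius_bessel.
  - unfold bessel_entire.
    transitivity (- / (4 * (a + 1)) * PSeries (bessel_coeff (a + 1)) t); [ | field; lra].
    rewrite <- PSeries_scal. apply PSeries_ext. intros n.
    now apply bessel_coeff_succ.
Qed.

Lemma bessel_entire_lower (a t : R) : 0 < a ->
  t * (- bessel_entire (a + 1) t / (4 * (a + 1)))
  = a * (bessel_entire (a - 1) t - bessel_entire a t).
Proof.
  intros Ha.
  rewrite <- (is_derive_unique _ _ _ (is_derive_bessel_entire a t ltac:(lra))).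
  unfold bessel_entire. rewrite Derive_PSeries by (rewrite CV_radius_bessel; [exact I | lra]).
  rewrite <- PSeries_incr_1, <- PSeries_minus by (apply ex_pseries_bessel; lra).
  rewrite <- PSeries_scal. apply PSeries_ext. intros n.
  transitivity (INR n * bessel_coeff a n); [ | now apply bessel_coeff_lower].
  (* The series of [t A'] has constant term [0] by the shift, in agreement with the factor
     [INR 0]. *)
  destruct n as [ | n]; [symmetry; apply Rmult_0_l | reflexivity].
Qed.

Lemma continuous_bessel_entire (a t : R) : -1 < a -> continuous (bessel_entire a) t.
Proof.
  intros Ha. apply @ex_derive_continuous. eexists. now apply is_derive_bessel_entire.
Qed.

(** * Positivity passed from one order to the next *)

Lemma MVT_open (f df : R -> R) (a b : R) : a < b ->
  (forall t, a <= t <= b -> is_derive f t (df t)) ->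
  exists c, f b - f a = df c * (b - a) /\ a < c < b.
Proof.
  intros Hab H. apply MVT_cor2; [exact Hab | ].
  intros c Hc. now apply is_derive_Reals, H.
Qed.

(** By the mean value theorem [f u <= f t] for [u < t]; then [u] tends to [0]. A right limit stands
    in for the value at [0] because [Rpower 0 e] is not [0]. *)
Lemma nonneg_of_right_limit (f df : R -> R) (T : R) :
  filterlim f (at_right 0) (locally 0) ->
  (forall t, 0 < t <= T -> is_derive f t (df t)) ->
  (forall t, 0 < t < T -> 0 <= df t) ->
  forall t, 0 < t <= T -> 0 <= f t.
Proof.
  intros L D N t Ht.
  apply (filterlim_le (F := at_right 0) f (fun _ => f t) 0 (f t)).
  - exists (mkposreal t (proj1 Ht)). intros u Hu Hu0.
    apply Rabs_lt_between' in Hu. simpl in Hu.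
    destruct (MVT_open f df u t) as (c & E & Hc); [lra | intros; apply D; lra | ].
    assert (0 <= df c) by (apply N; lra). nra.
  - exact L.
  - apply filterlim_const.
Qed.

(* [(t^a Phi_a)' = a t^(a-1) Phi_(a-1)], where [Phi_a] is [bessel_entire a]. *)
Lemma bessel_entire_pos_step (a T : R) : 0 < a ->
  (forall t, 0 < t < T -> 0 < bessel_entire (a - 1) t) ->
  forall t, 0 <= t <= T -> 0 < bessel_entire a t.
Proof.
  intros Ha Hpos t Ht.
  destruct (Req_dec t 0) as [-> | Hne]; [rewrite bessel_entire_0; lra | ].
  set (f := fun t => Rpower t a * bessel_entire a t).
  set (df := fun t => a * Rpower t (a - 1) * bessel_entire (a - 1) t).
  assert (D : forall u, 0 < u -> is_derive f u (df u)).
  { intros u Hu. unfold f, df. evar_last.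
    - apply Derive.is_derive_mult;
        [now apply is_derive_Rpower | apply is_derive_bessel_entire; lra].
    - cbv beta. assert (E := bessel_entire_lower a u Ha).
      replace (Rpower u a) with (Rpower u (a - 1) * u).
      + apply (f_equal (Rmult (Rpower u (a - 1)))) in E. lra.
      + rewrite <- (Rpower_1 u Hu) at 2. rewrite <- Rpower_plus. f_equal. ring. }
  assert (Dpos : forall u, 0 < u < T -> 0 < df u).
  { intros u Hu. repeat apply Rmult_lt_0_compat; [exact Ha | apply exp_pos | now apply Hpos]. }
  (* The limit argument gives only [0 <= f] at [t / 2]; strict growth from [t / 2] to [t] makes
     [f t] positive. The mean value point lies below [T], so [t = T] is reached even if the lower
     order vanishes there. *)
  assert (H2 : 0 <= f (t / 2)).
  { apply (nonneg_of_right_limit f df T); [ | | | lra].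
    - apply filterlim_Rpower_mult_at_right_0; [exact Ha | ].
      apply continuous_bessel_entire. lra.
    - intros; apply D; lra.
    - intros; apply Rlt_le, Dpos; lra. }
  destruct (MVT_open f df (t / 2) t) as (c & E & Hc); [lra | intros; apply D; lra | ].
  assert (0 < df c) by (apply Dpos; lra).
  assert (Hf : 0 < f t) by nra.
  apply Rmult_lt_reg_l with (Rpower t a); [apply exp_pos | ].
  rewrite Rmult_0_r. exact Hf.
Qed.

(** * The ratio of consecutive orders, by concavity *)

(** Divided by [B], the claim is [v t >= v 0 * (1 - t / T)], which holds for a concave [v] with
    [v T >= 0]. *)
Lemma bessel_ratio_lower (a T : R) : 0 < a -> 0 < T ->
  (forall t, 0 <= t <= T -> 0 < bessel_entire a t) ->
  (forall t, 0 <= t <= T -> 0 < bessel_entire (a + 1) t) ->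
  forall t, 0 < t < T -> (T - t) * bessel_entire (a + 1) t <= T * bessel_entire a t.
Proof.
  intros Ha HT.
  set (A := bessel_entire a). set (B := bessel_entire (a + 1)). intros PA PB.
  set (b := fun t => - bessel_entire (a + 1 + 1) t / (4 * (a + 1 + 1))).
  assert (DA : forall t, is_derive A t (- B t / (4 * (a + 1))))
    by (intros; apply is_derive_bessel_entire; lra).
  assert (DB : forall t, is_derive B t (b t))
    by (intros; apply is_derive_bessel_entire; lra).
  assert (Eb : forall t, t * b t = (a + 1) * (A t - B t)).
  { intros t. unfold A. replace a with (a + 1 - 1) at 2 by ring.
    apply bessel_entire_lower. lra. }
  assert (B0 : B 0 = 1) by apply bessel_entire_0.
  assert (A0 : A 0 = 1) by apply bessel_entire_0.
  (* [p] is [v'] by the quotient rule, and [r] is the right-hand side of the Riccati equation, so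
     [Ep] below is that equation. *)
  set (v := fun t => 4 * (a + 1) * (A t / B t)).
  set (p := fun t => 4 * (a + 1) * ((- B t / (4 * (a + 1)) * B t - A t * b t) / B t ^ 2)).
  set (r := fun t => - t + (a + 1) * v t - v t ^ 2 / 4).
  clearbody A B b.
  assert (Dv : forall t, 0 <= t <= T -> is_derive v t (p t)).
  { intros t Ht. apply is_derive_scal, is_derive_div; try easy.
    specialize (PB t Ht). lra. }
  assert (Ep : forall t, 0 <= t <= T -> t * p t = r t).
  { intros t Ht. specialize (PB t Ht). unfold p, r, v.
    replace (t * (4 * (a + 1) * ((- B t / (4 * (a + 1)) * B t - A t * b t) / B t ^ 2)))
      with (4 * (a + 1) * ((- t * B t ^ 2 / (4 * (a + 1)) - A t * (t * b t)) / B t ^ 2))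
      by (field; lra).
    rewrite Eb. field. lra. }
  assert (Dr : forall t, 0 <= t <= T -> is_derive r t (- 1 + (a + 1 - v t / 2) * p t)).
  { intros t Ht. unfold r. assert (H := Dv t Ht). auto_derive.
    - split; [now exists (p t) | split; [now exists (p t) | exact I]].
    - replace (Derive (fun x => v x) t) with (p t) by (symmetry; now apply is_derive_unique).
      field. }
  (* Near an interior point [p = r / u], which can be differentiated by [Dr] alone; the result is
     [v'']. *)
  assert (Dp : forall t, 0 < t < T -> is_derive p t ((- 1 + (a - v t / 2) * p t) / t)).
  { intros t Ht. apply is_derive_ext_loc with (fun u => r u / u).
    - assert (O : locally t (fun u => 0 < u < T)).
      { apply (open_and (fun u => 0 < u) (fun u => u < T));
          [apply open_gt | apply open_lt | exact Ht]. }
      apply filter_imp with (2 := O). intros u Hu.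
      rewrite <- Ep by lra. change (@eq R (u * p u / u) (p u)). field. lra.
    - evar_last.
      + apply is_derive_div; [apply Dr; lra | apply @is_derive_id | lra].
      + unfold one; simpl. rewrite <- Ep by lra.
        match goal with |- @eq _ ?x ?y => change (@eq R x y) end. field. lra. }
  (* [K = - t^(a+3) B^2 v''], with the Riccati equation used to clear [v' = r / t]. *)
  set (K := fun t => Rpower t (a + 1) * (B t ^ 2 * (t - (a - v t / 2) * r t))).
  set (k := fun t => Rpower t a * (B t ^ 2 * r t ^ 2 / 2)).
  assert (DK : forall t, 0 < t <= T -> is_derive K t (k t)).
  { intros t Ht. unfold K, k. assert (Ht' : 0 <= t <= T) by lra.
    set (g := fun t => B t ^ 2 * (t - (a - v t / 2) * r t)).
    set (dg := 2 * B t * b t * (t - (a - v t / 2) * r t)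
      + B t ^ 2 * (1 + p t / 2 * r t - (a - v t / 2) * (- 1 + (a + 1 - v t / 2) * p t))).
    assert (Dg : is_derive g t dg).
    { unfold g. assert (H1 := Dv t Ht'). assert (H2 := DB t). assert (H3 := Dr t Ht').
      auto_derive.
      - repeat split; now (eexists; eassumption).
      - replace (Derive (fun x => v x) t) with (p t) by (symmetry; now apply is_derive_unique).
        replace (Derive (fun x => B x) t) with (b t) by (symmetry; now apply is_derive_unique).
        replace (Derive (fun x => r x) t) with (- 1 + (a + 1 - v t / 2) * p t)
          by (symmetry; now apply is_derive_unique).
        unfold dg. field. }
    evar_last.
    - apply (Derive.is_derive_mult (fun t => Rpower t (a + 1)) g); [ | exact Dg].
      apply is_derive_Rpower. lra.
    - replace (a + 1 - 1) with a by ring.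
      rewrite Rpower_plus, Rpower_1 by lra.
      enough (E : (a + 1) * g t + t * dg = B t ^ 2 * r t ^ 2 / 2)
        by (rewrite <- E; ring).
      assert (E1 := Eb t). assert (E2 := Ep t Ht').
      assert (E3 : v t * B t = 4 * (a + 1) * A t).
      { unfold v. specialize (PB t Ht'). field. lra. }
      (* The factor [t] is distributed to form [t * b t] and [t * p t], which [Eb] and [Ep]
         eliminate; a polynomial identity in [t], [B t] and [v t] remains. *)
      transitivity ((a + 1) * g t + 2 * B t * (t * b t) * (t - (a - v t / 2) * r t)
        + B t ^ 2 * (t + (t * p t) / 2 * r t
             - (a - v t / 2) * (- t + (a + 1 - v t / 2) * (t * p t))));
        [unfold dg; field | ].
      rewrite E1, E2. unfold g.
      replace (2 * B t * ((a + 1) * (A t - B t)))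
        with (B t * (v t * B t) / 2 - 2 * (a + 1) * B t ^ 2) by (rewrite E3; field).
      field. }
  assert (K0 : filterlim K (at_right 0) (locally 0)).
  { apply filterlim_Rpower_mult_at_right_0; [lra | ].
    assert (H1 := Dv 0 ltac:(lra)). assert (H2 := DB 0). assert (H3 := Dr 0 ltac:(lra)).
    apply @ex_derive_continuous. auto_derive.
    repeat split; now (eexists; eassumption). }
  assert (Kpos : forall t, 0 < t <= T -> 0 <= K t).
  { apply (nonneg_of_right_limit K k T K0 DK). intros t Ht. unfold k.
    apply Rmult_le_pos; [apply Rlt_le, exp_pos | ].
    assert (0 <= (B t * r t) ^ 2) by apply pow2_ge_0.
    rewrite Rpow_mult_distr in H. lra. }
  (* Dividing [K t] by the positive [t^(a+1) B^2] gives [v'' <= 0]. *)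
  assert (Hconc : forall t, 0 < t < T -> (- 1 + (a - v t / 2) * p t) / t <= 0).
  { intros t Ht. assert (H := Kpos t ltac:(lra)). unfold K in H.
    rewrite <- Ep in H by lra.
    assert (PB' := PB t ltac:(lra)).
    assert (P1 : 0 < Rpower t (a + 1)) by apply exp_pos.
    assert (P2 : 0 < B t ^ 2) by (now apply pow_lt).
    assert (H' : 0 <= t - (a - v t / 2) * (t * p t)).
    { apply Rmult_le_reg_l with (Rpower t (a + 1) * B t ^ 2); [now apply Rmult_lt_0_compat | ].
      rewrite Rmult_0_r, Rmult_assoc. exact H. }
    assert (P3 : 0 < / t) by (apply Rinv_0_lt_compat; lra).
    replace ((- 1 + (a - v t / 2) * p t) / t)
      with (- (/ t * / t * (t - (a - v t / 2) * (t * p t)))) by (field; lra).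
    assert (0 <= / t * / t * (t - (a - v t / 2) * (t * p t))); [ | lra].
    apply Rmult_le_pos; [ | exact H']. apply Rmult_le_pos; lra. }
  intros t Ht.
  (* The slopes of [v] over [[0, t]] and [[t, T]] are [p c1] and [p c2]; a third mean value step,
     inside the open interval where [v''] is known, gives [p c2 <= p c1]. *)
  destruct (MVT_open v p 0 t) as (c1 & F1 & Hc1); [lra | intros; apply Dv; lra | ].
  destruct (MVT_open v p t T) as (c2 & F2 & Hc2); [lra | intros; apply Dv; lra | ].
  destruct (MVT_open p (fun t => (- 1 + (a - v t / 2) * p t) / t) c1 c2) as (c3 & F3 & Hc3);
    [lra | intros; apply Dp; lra | ].
  assert (L := Hconc c3 ltac:(lra)).
  assert (Pc : p c2 <= p c1) by nra.
  assert (v0 : v 0 = 4 * (a + 1)) by (unfold v; rewrite A0, B0; field).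
  assert (vT : 0 <= v T).
  { unfold v. apply Rmult_le_pos; [lra | ].
    apply Rlt_le, Rdiv_lt_0_compat; [apply PA | apply PB]; lra. }
  assert (PB' := PB t ltac:(lra)).
  (* The graph of [v] at [t] lies above the chord over [[0, T]], and [v T] is dropped as
     nonnegative. *)
  assert (Q : (T - t) * (4 * (a + 1)) <= T * v t).
  { rewrite <- v0.
    assert (X : (v T - v t) * t <= (v t - v 0) * (T - t)).
    { rewrite F1, F2.
      assert (0 < (T - t) * t) by (apply Rmult_lt_0_compat; lra). nra. }
    assert (0 <= v T * t) by (apply Rmult_le_pos; lra). lra. }
  assert (Ev : v t * B t = 4 * (a + 1) * A t) by (unfold v; field; lra).
  apply Rmult_le_reg_l with (4 * (a + 1)); [lra | ].
  replace (4 * (a + 1) * (T * A t)) with (T * v t * B t) by (rewrite Rmult_assoc, Ev; ring).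
  replace (4 * (a + 1) * ((T - t) * B t)) with ((T - t) * (4 * (a + 1)) * B t) by ring.
  apply Rmult_le_compat_r; lra.
Qed.

(** * Positivity before the first zero, monotonicity and the lower bound *)

(** The function is [1] at [0]; a nonpositive value at [t] would give a zero [s <= t < j^2], hence a
    zero [sqrt s] of [BesselJ nu] below [j]. *)
Lemma bessel_entire_pos_before_zero (nu j : R) : -1 < nu ->
  is_first_positive_zero (BesselJ nu) j ->
  forall t, 0 <= t < j ^ 2 -> 0 < bessel_entire nu t.
Proof.
  intros Hnu [[Hj _] Hmin] t Ht. apply Rnot_le_lt. intros Hle.
  destruct (IVT_cor (bessel_entire nu) 0 t) as (s & Hs & Es); [ | lra | | ].
  - intros u. now apply continuity_pt_filterlim, continuous_bessel_entire.
  - rewrite bessel_entire_0. lra.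
  - assert (Hs0 : 0 < s).
    { destruct (Req_dec s 0) as [-> | ]; [ | lra]. rewrite bessel_entire_0 in Es. lra. }
    assert (H : j <= sqrt s).
    { apply Hmin. split; [now apply sqrt_lt_R0 | ].
      rewrite BesselJ_entire by (try apply sqrt_lt_R0; assumption).
      rewrite pow2_sqrt, Es by lra. ring. }
    assert (H2 := pow_incr j (sqrt s) 2 (conj (Rlt_le _ _ Hj) H)).
    rewrite pow2_sqrt in H2; lra.
Qed.

(** Serves both the upper bound, through the value [1] at [0], and the optimality of [delta]. *)
Lemma bessel_entire_decr (a T : R) : -1 < a ->
  (forall t, 0 <= t <= T -> 0 < bessel_entire (a + 1) t) ->
  forall s t, 0 <= s -> s <= t -> t <= T -> bessel_entire a t <= bessel_entire a s.
Proof.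
  intros Ha PB s t Hs Hst HtT. destruct (Req_dec s t) as [-> | Hne]; [lra | ].
  destruct (MVT_open (bessel_entire a) (fun t => - bessel_entire (a + 1) t / (4 * (a + 1))) s t)
    as (c & E & Hc); [lra | intros; now apply is_derive_bessel_entire | ].
  assert (P := PB c ltac:(lra)).
  assert (0 < bessel_entire (a + 1) c / (4 * (a + 1))) by (apply Rdiv_lt_0_compat; lra).
  rewrite Rdiv_opp_l in E. nra.
Qed.

Lemma bessel_entire_Rpower_lower (a T : R) : 0 < a -> 0 < T ->
  (forall t, 0 <= t <= T -> 0 < bessel_entire a t) ->
  (forall t, 0 <= t <= T -> 0 < bessel_entire (a + 1) t) ->
  forall t, 0 <= t < T ->
  Rpower ((T - t) / T) (T / (4 * (a + 1))) <= bessel_entire a t.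
Proof.
  intros Ha HT PA PB t Ht. set (g := T / (4 * (a + 1))).
  destruct (Req_dec t 0) as [-> | Hne].
  { rewrite bessel_entire_0. replace ((T - 0) / T) with 1 by (field; lra).
    unfold Rpower. rewrite ln_1, Rmult_0_r, exp_0. lra. }
  set (f := fun t => ln (bessel_entire a t) - g * ln ((T - t) / T)).
  set (df := fun t => - bessel_entire (a + 1) t / (4 * (a + 1)) / bessel_entire a t
                      + g / (T - t)).
  destruct (MVT_open f df 0 t) as (c & E & Hc); [lra | | ].
  - intros u Hu. assert (PA' := PA u ltac:(lra)).
    assert (0 < (T - u) / T) by (apply Rdiv_lt_0_compat; lra).
    assert (D := is_derive_bessel_entire a u ltac:(lra)).
    unfold f. auto_derive.
    + repeat split; try assumption. now eexists; eassumption.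
    + replace (Derive (fun x => bessel_entire a x) u)
        with (- bessel_entire (a + 1) u / (4 * (a + 1)))
        by (symmetry; now apply is_derive_unique).
      unfold df. field. lra.
  - assert (L := bessel_ratio_lower a T Ha HT PA PB c ltac:(lra)).
    assert (PA' := PA c ltac:(lra)).
    (* Over the common denominator, the numerator of [df c] is the difference of the two sides of
       [bessel_ratio_lower]. *)
    assert (Q : 0 <= df c).
    { replace (df c) with ((T * bessel_entire a c - (T - c) * bessel_entire (a + 1) c)
        * / (4 * (a + 1) * bessel_entire a c * (T - c))) by (unfold df, g; field; lra).
      apply Rmult_le_pos; [lra | ]. apply Rlt_le, Rinv_0_lt_compat.
      repeat apply Rmult_lt_0_compat; lra. }
    assert (F0 : f 0 = 0).
    { unfold f. rewrite bessel_entire_0. replace ((T - 0) / T) with 1 by (field; lra).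
      rewrite ln_1. ring. }
    assert (F : 0 <= f t) by nra.
    unfold f in F. rewrite <- (exp_ln (bessel_entire a t)) by (apply PA; lra).
    unfold Rpower. destruct (Req_dec (g * ln ((T - t) / T)) (ln (bessel_entire a t))) as [-> | ].
    + lra.
    + apply Rlt_le, exp_increasing. lra.
Qed.

(** * Optimality of the exponents *)

(** If [l < 0], a difference quotient at a small [h > 0] within [- l] of [l] would be negative. *)
Lemma is_derive_nonneg_right (f : R -> R) (l T : R) : 0 < T ->
  is_derive f 0 l -> f 0 = 0 -> (forall t, 0 < t < T -> 0 <= f t) -> 0 <= l.
Proof.
  intros HT D F0 P. apply is_derive_Reals in D. apply Rnot_lt_le. intros Hl.
  destruct (D (- l) ltac:(lra)) as [d Hd].
  assert (Hd0 := cond_pos d).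
  set (h := Rmin d T / 2).
  assert (Hm : 0 < Rmin d T) by (now apply Rmin_glb_lt).
  assert (H1 := Rmin_l d T). assert (H2 := Rmin_r d T).
  specialize (Hd h ltac:(unfold h; lra) ltac:(unfold h; rewrite Rabs_pos_eq; lra)).
  rewrite Rplus_0_l, F0, Rminus_0_r in Hd.
  assert (0 <= f h / h).
  { apply Rmult_le_pos; [apply P; unfold h; lra | ].
    apply Rlt_le, Rinv_0_lt_compat. unfold h; lra. }
  apply Rabs_lt_between in Hd. lra.
Qed.

(** The difference of the two sides vanishes at [0] and is nonnegative to its right, so its
    derivative there, [g / T - 1 / (4 (a + 1))], is nonnegative. *)
Lemma bessel_entire_exponent_lower (a T g : R) : -1 < a -> 0 < T ->
  (forall t, 0 <= t < T -> Rpower ((T - t) / T) g <= bessel_entire a t) ->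
  T / (4 * (a + 1)) <= g.
Proof.
  intros Ha HT H.
  assert (Q : 0 <= - bessel_entire (a + 1) 0 / (4 * (a + 1)) + g / T).
  { apply (is_derive_nonneg_right
      (fun t => bessel_entire a t - Rpower ((T - t) / T) g) _ T HT).
    - assert (D := is_derive_bessel_entire a 0 Ha).
      assert (E : (T - 0) / T = 1) by (field; lra).
      unfold Rpower. auto_derive; fold (T - 0); fold ((T - 0) / T); rewrite E.
      + repeat split; try lra. now eexists; eassumption.
      + replace (Derive (fun x => bessel_entire a x) 0)
          with (- bessel_entire (a + 1) 0 / (4 * (a + 1)))
          by (symmetry; now apply is_derive_unique).
        rewrite ln_1, Rmult_0_r, exp_0. field. lra.
    - rewrite bessel_entire_0. replace ((T - 0) / T) with 1 by (field; lra).
      unfold Rpower. rewrite ln_1, Rmult_0_r, exp_0. ring.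
    - intros t Ht. specialize (H t ltac:(lra)). lra. }
  rewrite bessel_entire_0 in Q.
  apply Rmult_le_reg_r with (/ T); [now apply Rinv_0_lt_compat | ].
  replace (T / (4 * (a + 1)) * / T) with (1 / (4 * (a + 1))) by (field; lra).
  rewrite Rdiv_opp_l in Q. unfold Rdiv in *. lra.
Qed.

Lemma Rpower_vanishing_factor (T d m : R) : 0 < T -> 0 < d -> 0 < m ->
  exists t, 0 <= t < T /\ Rpower ((T - t) / T) d < m.
Proof.
  intros HT Hd Hm.
  (* [s] will be the base [(T - t) / T]: the second bound gives [s^d <= m / 2], and the cap [1 / 2]
     keeps [t] nonnegative. *)
  set (s := Rmin (1 / 2) (Rpower (m / 2) (/ d))).
  assert (P : 0 < Rpower (m / 2) (/ d)) by apply exp_pos.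
  assert (Hs : 0 < s) by (apply Rmin_glb_lt; lra).
  assert (H1 : s <= 1 / 2) by apply Rmin_l.
  assert (H2 : s <= Rpower (m / 2) (/ d)) by apply Rmin_r.
  exists (T * (1 - s)). split; [nra | ].
  replace ((T - T * (1 - s)) / T) with s by (field; lra).
  apply Rle_lt_trans with (Rpower (Rpower (m / 2) (/ d)) d).
  - apply Rle_Rpower_l; lra.
  - rewrite Rpower_mult, Rinv_l, Rpower_1; lra.
Qed.

(** * Return from [t] to [x], with [a = nu + 1] *)

Theorem theorem2 (nu j : R) (hnu : -1 < nu)
    (hj : is_first_positive_zero (BesselJ nu) j) :
  let gamma := j ^ 2 / (4 * (nu + 2)) in
  let delta := 0 in
  (forall x : R, Rabs x < j ->
     Rpower ((j ^ 2 - x ^ 2) / j ^ 2) gamma <= NormBesselJ (nu + 1) x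
     <= Rpower ((j ^ 2 - x ^ 2) / j ^ 2) delta) /\
  is_smallest (fun g : R => forall x : R, Rabs x < j ->
     Rpower ((j ^ 2 - x ^ 2) / j ^ 2) g <= NormBesselJ (nu + 1) x) gamma /\
  is_largest (fun d : R => forall x : R, Rabs x < j ->
     NormBesselJ (nu + 1) x <= Rpower ((j ^ 2 - x ^ 2) / j ^ 2) d) delta.
Proof.
  intros gamma delta.
  assert (Hj : 0 < j) by apply hj.
  set (T := j ^ 2). assert (HT : 0 < T) by (now apply pow_lt).
  (* Order [nu] is positive only on [[0, T)]; raising the order gains the endpoint [T], which the
     next raise and the optimality of [delta] use. *)
  assert (PA : forall t, 0 <= t <= T -> 0 < bessel_entire (nu + 1) t).
  { apply bessel_entire_pos_step; [lra | ]. replace (nu + 1 - 1) with nu by ring.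
    intros t Ht. apply (bessel_entire_pos_before_zero nu j hnu hj). fold T. lra. }
  assert (PB : forall t, 0 <= t <= T -> 0 < bessel_entire (nu + 1 + 1) t).
  { apply bessel_entire_pos_step; [lra | ]. replace (nu + 1 + 1 - 1) with (nu + 1) by ring.
    intros t Ht. apply PA. lra. }
  assert (Eg : gamma = T / (4 * (nu + 1 + 1))).
  { unfold gamma, T. f_equal. ring. }
  assert (Sq : forall x, Rabs x < j -> 0 <= x ^ 2 < T).
  { intros x Hx. split; [apply pow2_ge_0 | ]. rewrite <- pow2_abs.
    assert (0 <= Rabs x) by apply Rabs_pos. unfold T. nra. }
  assert (Sqrt : forall t, 0 <= t < T -> Rabs (sqrt t) < j /\ sqrt t ^ 2 = t).
  { intros t Ht. split; [ | apply pow2_sqrt; lra].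
    rewrite Rabs_pos_eq by apply sqrt_pos.
    rewrite <- (sqrt_pow2 j) by lra. now apply sqrt_lt_1_alt. }
  assert (Lo : forall x, Rabs x < j ->
    Rpower ((T - x ^ 2) / T) gamma <= NormBesselJ (nu + 1) x).
  { intros x Hx. rewrite Eg, NormBesselJ_entire by lra.
    apply bessel_entire_Rpower_lower; try assumption; [lra | now apply Sq]. }
  assert (Up : forall x, Rabs x < j ->
    NormBesselJ (nu + 1) x <= Rpower ((T - x ^ 2) / T) delta).
  { intros x Hx. specialize (Sq x Hx). unfold delta.
    rewrite Rpower_O by (apply Rdiv_lt_0_compat; lra).
    rewrite NormBesselJ_entire by lra.
    apply Rle_trans with (bessel_entire (nu + 1) 0); [ | rewrite bessel_entire_0; lra].
    apply (bessel_entire_decr (nu + 1) T); try assumption; lra. }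
  split; [intros x Hx; split; auto | split; split; try assumption].
  - intros g Hg. rewrite Eg. apply bessel_entire_exponent_lower; try lra.
    intros t Ht. destruct (Sqrt t Ht) as [Hx E].
    specialize (Hg _ Hx). rewrite NormBesselJ_entire, E in Hg by lra. exact Hg.
  (* For [d > 0] the power drops below the positive value at [T] of the decreasing function that it
     should dominate. *)
  - intros d Hd. apply Rnot_lt_le. intros Hpos. unfold delta in Hpos.
    destruct (Rpower_vanishing_factor T d (bessel_entire (nu + 1) T)) as (t & Ht & Hlt);
      try assumption; [apply PA; lra | ].
    destruct (Sqrt t Ht) as [Hx E].
    specialize (Hd _ Hx). rewrite NormBesselJ_entire, E in Hd by lra. fold T in Hd.
    assert (D := bessel_entire_decr (nu + 1) T ltac:(lra) PB t T
      ltac:(lra) ltac:(lra) ltac:(lra)).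
    lra.
Qed.
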